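(* Let $f:\mathbb{R}^n\to\mathbb{R}\cup\{+\infty\}$ and $g:\mathbb{R}^p\to\mathbb{R}\cup\{+\infty\}$ be proper lower semicontinuous convex functions, $A\in\mathbb{R}^{m\times n}$, $B\in\mathbb{R}^{m\times p}$, $b\in\mathbb{R}^m$, and $\eta>0$. Consider the primal-dual problem $\min_{x,y}\max_\lambda L(x,y,\lambda)=f(x)+g(y)-\lambda^T(Ax+By-b)$, and let $(x^k,y^k,\lambda^k)$ be generated from an initial point $(x^0,\lambda^0)$ (and arbitrary $y^0$) by the alternating direction method of multipliers (ADMM): for $k\ge0$, $$y^{k+1}\in\arg\min_y\Big\{g(y)-\langle B^T\lambda^k,y\rangle+\tfrac\eta2\|Ax^k+By-b\|_2^2\Big\},$$ $$\lambda^{k+1}=\lambda^k-\eta(Ax^k+By^{k+1}-b),$$ $$x^{k+1}\in\arg\min_x\Big\{f(x)-\langle A^T\lambda^{k+1},x\rangle+\tfrac\eta2\|Ax+By^{k+1}-b\|_2^2\Big\}.$$ Let $z^k=(y^k,x^k,\lambda^k)$. Then, with the positive semidefinite matrix $$P=\begin{pmatrix}0 & 0 & 0 \\ 0 & \eta A^TA & -A^T \\ 0 & -A & \frac1\eta I\end{pmatrix},$$ for all $k\ge0$, $$P(z^k-z^{k+1})\in\mathcal{F}(z^{k+1}).$$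
   Context: Variables are ordered as $z=(y,x,\lambda)$, with $(y,x)$ the primal variable and $\lambda$ the dual variable, and $$\mathcal{F}(z)=\begin{pmatrix}\partial_yL \\ \partial_xL \\ -\partial_\lambda L\end{pmatrix}=\begin{pmatrix}\partial g(y)-B^T\lambda \\ \partial f(x)-A^T\lambda \\ Ax+By-b\end{pmatrix},$$ with $\partial$ the convex subdifferential. The minimizers in the ADMM updates are assumed to exist (any minimizer may be chosen). *)

(* Defs.v *)
From mathcomp Require Import all_boot all_order all_algebra.
From mathcomp Require Import boolp classical_sets reals ereal topology normedtype.

Set Implicit Arguments.
Unset Strict Implicit.
Unset Printing Implicit Defensive.
Import Order.TTheory GRing.Theory Num.Theory.
Import numFieldNormedType.Exports.
Local Open Scope classical_set_scope.
Local Open Scope ring_scope.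

Section Euclidean.
Context {R : realType} {n : nat}.

Definition dot (u v : 'cV[R]_n) : R := (u^T *m v) 0 0.

(* The library norm `|u| on matrices is the sup norm. *)
Definition norm2 (u : 'cV[R]_n) : R := Num.sqrt (dot u u).

Definition psd (M : 'M[R]_n) : Prop :=
  M^T = M /\ forall u : 'cV[R]_n, 0 <= dot u (M *m u).

End Euclidean.

Section ConvexAnalysis.
Context {R : realType} {n : nat}.
Implicit Types (f : 'cV[R]_n -> \bar R) (x : 'cV[R]_n).
Local Open Scope ereal_scope.

(* Excluding the value -oo is what makes the codomain R U {+oo}. *)
Definition proper_fun f : Prop :=
  (forall x, f x != -oo) /\ (exists x, f x != +oo).

(* The library's convex_function is for real-valued functions only. *)
Definition econvex f : Prop :=
  forall (x y : 'cV[R]_n) (t : R), (0 < t < 1)%R ->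
    f (t *: x + (1 - t) *: y)%R <= t%:E * f x + (1 - t)%:E * f y.

(* For proper f this set is empty wherever f x = +oo. *)
Definition subdiff f x : set 'cV[R]_n :=
  [set v | forall y, f x + (dot v (y - x)%R)%:E <= f y].

Definition argmin f : set 'cV[R]_n :=
  [set x | forall y, f x <= f y].

End ConvexAnalysis.

Section ADMM.
Context {R : realType} {n p m : nat}.
Variables (f : 'cV[R]_n -> \bar R) (g : 'cV[R]_p -> \bar R).
Variables (A : 'M[R]_(m, n)) (B : 'M[R]_(m, p)) (b : 'cV[R]_m) (eta : R).

Definition pdvec (y : 'cV[R]_p) (x : 'cV[R]_n) (lam : 'cV[R]_m) :
    'cV[R]_(p + (n + m)) :=
  col_mx y (col_mx x lam).

(* (d_y L, d_x L, - d_lam L) for the Lagrangian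
   L(x, y, lam) = f x + g y - lam^T (A x + B y - b). *)
Definition saddle_op (z : 'cV[R]_(p + (n + m))) :
    set 'cV[R]_(p + (n + m)) :=
  let y := usubmx z in
  let x := usubmx (dsubmx z) in
  let lam := dsubmx (dsubmx z) in
  [set w | exists2 u, subdiff g y u & exists2 v, subdiff f x v &
    w = pdvec (u - B^T *m lam) (v - A^T *m lam) (A *m x + B *m y - b)].

Definition admm (y : nat -> 'cV[R]_p) (x : nat -> 'cV[R]_n)
    (lam : nat -> 'cV[R]_m) : Prop :=
  forall k,
  [/\ argmin (fun y' => g y' - (dot (B^T *m lam k) y')%:E
        + (eta / 2 * norm2 (A *m x k + B *m y' - b) ^+ 2)%:E)%E (y k.+1),
      lam k.+1 = lam k - eta *: (A *m x k + B *m y k.+1 - b)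
    & argmin (fun x' => f x' - (dot (A^T *m lam k.+1) x')%:E
        + (eta / 2 * norm2 (A *m x' + B *m y k.+1 - b) ^+ 2)%:E)%E (x k.+1)].

Definition admm_mx : 'M[R]_(p + (n + m)) :=
  block_mx 0 0
           0 (block_mx (eta *: (A^T *m A)) (- A^T)
                       (- A)               (eta^-1)%:M).

End ADMM.

Arguments admm_mx {R n} p {m} A eta.

(* Main.v *)
Require Import Defs.
From HB Require Import structures.
From mathcomp Require Import all_boot all_order all_algebra.
From mathcomp Require Import boolp classical_sets reals ereal topology normedtype.
From mathcomp Require Import ring lra.

Set Implicit Arguments.
Unset Strict Implicit.
Unset Printing Implicit Defensive.
Import Order.TTheory GRing.Theory Num.Theory.
Import numFieldNormedType.Exports.
Local Open Scope classical_set_scope.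
Local Open Scope ring_scope.

(** Each ADMM update minimizes a convex function [h] plus a finite quadratic
    [q], and at such a minimizer the negative gradient of [q] is a subgradient
    of [h] ([subdiff_argmin_add]).  In the [y]-update the gradient of the
    quadratic part is [- B^T lam^{k+1}], by the very choice of the dual step
    length [eta]; in the [x]-update it is [- A^T lam^{k+1} + eta A^T res], where
    [res = A x^{k+1} + B y^{k+1} - b] is the new primal residual.  Hence the
    saddle operator at [z^{k+1}] contains [(0, - eta A^T res, res)].

    On the other side, [P] only sees a vector [(y, x, l)] through
    [r = eta A x - l], namely [P (y, x, l) = (0, A^T r, - r / eta)]
    ([admm_mxE]).  The dual update says precisely that for [z^k - z^{k+1}] this
    [r] is [- eta res], so the two vectors agree.  The same formula for [P]
    gives [<u, P u> = |r|^2 / eta], hence the positive semidefiniteness. *)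

(** * The Euclidean inner product *)

Section Dot.
Context {R : realType}.

Lemma dotE n (u v : 'cV[R]_n) : dot u v = \sum_i u i 0 * v i 0.
Proof. by rewrite /dot mxE; apply: eq_bigr => i _; rewrite mxE. Qed.

Lemma dotC n (u v : 'cV[R]_n) : dot u v = dot v u.
Proof. by rewrite !dotE; apply: eq_bigr => i _; rewrite mulrC. Qed.

Lemma dotDr n (u v w : 'cV[R]_n) : dot u (v + w) = dot u v + dot u w.
Proof. by rewrite /dot mulmxDr mxE. Qed.

Lemma dotZr n a (u v : 'cV[R]_n) : dot u (a *: v) = a * dot u v.
Proof. by rewrite /dot -scalemxAr mxE. Qed.

Lemma dotNr n (u v : 'cV[R]_n) : dot u (- v) = - dot u v.
Proof. by rewrite -scaleN1r dotZr mulN1r. Qed.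

Lemma dotDl n (u v w : 'cV[R]_n) : dot (u + v) w = dot u w + dot v w.
Proof. by rewrite dotC dotDr !(dotC w). Qed.

Lemma dotZl n a (u v : 'cV[R]_n) : dot (a *: u) v = a * dot u v.
Proof. by rewrite dotC dotZr dotC. Qed.

Lemma dotNl n (u v : 'cV[R]_n) : dot (- u) v = - dot u v.
Proof. by rewrite dotC dotNr dotC. Qed.

Lemma dot_trmxl m n (M : 'M[R]_(m, n)) u v :
  dot (M^T *m u) v = dot u (M *m v).
Proof. by rewrite /dot trmx_mul trmxK mulmxA. Qed.

Lemma dot_col_mx m n (u1 v1 : 'cV[R]_m) (u2 v2 : 'cV[R]_n) :
  dot (col_mx u1 u2) (col_mx v1 v2) = dot u1 v1 + dot u2 v2.
Proof. by rewrite /dot tr_col_mx mul_row_col mxE. Qed.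

Lemma dot_ge0 n (u : 'cV[R]_n) : 0 <= dot u u.
Proof. by rewrite dotE; apply: sumr_ge0 => i _; rewrite -expr2 sqr_ge0. Qed.

Lemma sqr_norm2 n (u : 'cV[R]_n) : norm2 u ^+ 2 = dot u u.
Proof. by rewrite sqr_sqrtr // dot_ge0. Qed.

End Dot.

(** * First-order optimality *)

Section FirstOrder.
Context {R : realType}.

Lemma ler_addgt0_mulP (a K : R) :
  (forall t, 0 < t < 1 -> 0 <= a + t * K) -> 0 <= a.
Proof.
move=> aK; rewrite leNgt; apply/negP => a_lt0.
(* This t lies in ]0, 1[ and satisfies t K < - a, whatever the sign of K. *)
pose D := 1 - a + `|K|; pose t := - a / D.
have K_le : K <= `|K| by exact: ler_norm.
have K_ge0 : 0 <= `|K| by [].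
have D_gt0 : 0 < D by rewrite /D; lra.
have tD : t * D = - a by rewrite /t divfK // gt_eqF.
have t_gt0 : 0 < t by rewrite divr_gt0 // oppr_gt0.
have t_lt1 : t < 1 by rewrite ltr_pdivrMr // mul1r /D; lra.
have := aK t; rewrite t_gt0 t_lt1 => /(_ isT).
have : t * K < t * D by rewrite ltr_pM2l // /D; lra.
rewrite tD; lra.
Qed.

(** The sum rule of subdifferential calculus in the case where one summand is
    finite and has a second-order expansion at the minimizer: compare the
    minimizer [x] with the points [x + t (y - x)] of a segment, bound [h] there
    by convexity, divide by [t] and let [t] tend to [0].  Only the linear term
    of [q], whose gradient is [- v], survives. *)
Lemma subdiff_argmin_add n (h : 'cV[R]_n -> \bar R) (q : 'cV[R]_n -> R)
    (x v : 'cV[R]_n) (K : 'cV[R]_n -> R) :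
  proper_fun h -> econvex h ->
  (forall d t, q (x + t *: d) = q x - t * dot v d + t ^+ 2 * K d) ->
  argmin (fun x' => h x' + (q x')%:E)%E x -> subdiff h x v.
Proof.
move=> [h_Ny [x0 hx0]] h_conv qE xmin y.
have : (h x < +oo)%E.
  have := xmin x0; move: hx0 (h_Ny x0); case: (h x0) => [r0| |] // _ _.
  by case: (h x) => [s| |] //; rewrite ltry.
move: (h_Ny x) (h_Ny y); case hx: (h x) => [s| |] // _.
case hy: (h y) => [r| |] // _ _.
  rewrite -EFinD lee_fin -subr_ge0.
  apply: (@ler_addgt0_mulP _ (K (y - x))) => t t01.
  have := h_conv y x t t01; have := xmin (x + t *: (y - x)).
  have -> : t *: y + (1 - t) *: x = x + t *: (y - x).
    by rewrite scalerBr scalerBl scale1r addrCA addrA [LHS]addrAC [RHS]addrAC.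
  rewrite hx hy qE; move: (h_Ny (x + t *: (y - x))).
  case: (h _) => [w| |] // _; rewrite -!EFinM -!EFinD !lee_fin => le1 le2.
  have /andP[t_gt0 _] := t01.
  rewrite -(pmulr_rge0 _ t_gt0); lra.
by rewrite leey.
Qed.

(** Both ADMM subproblems have this shape; [r] is the primal residual as a
    function of the block being updated, hence affine with linear part [M]. *)
Lemma subdiff_argmin_penalty n m (h : 'cV[R]_n -> \bar R) (M : 'M[R]_(m, n))
    (r : 'cV[R]_n -> 'cV[R]_m) (c x : 'cV[R]_n) (eta : R) :
  proper_fun h -> econvex h ->
  (forall x d, r (x + d) = r x + M *m d) ->
  argmin (fun x' => h x' - (dot c x')%:E
    + (eta / 2 * norm2 (r x') ^+ 2)%:E)%E x ->
  subdiff h x (c - eta *: (M^T *m r x)).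
Proof.
move=> h_proper h_conv rD xmin.
apply: (@subdiff_argmin_add _ _
  (fun x' => - dot c x' + eta / 2 * norm2 (r x') ^+ 2) _ _
  (fun d => eta / 2 * dot (M *m d) (M *m d))) => //.
  move=> d t; rewrite rD -scalemxAr !sqr_norm2.
  rewrite !(dotDl, dotDr, dotNl, dotZl, dotZr) dot_trmxl (dotC (M *m d) (r x)).
  by field.
by move=> x'; rewrite !EFinD !EFinN !addeA; exact: xmin.
Qed.

End FirstOrder.

(** * The ADMM preconditioner *)

Section Preconditioner.
Context {R : realType} {n p m : nat}.
Variables (A : 'M[R]_(m, n)) (eta : R).
Hypothesis eta_gt0 : 0 < eta.

Lemma admm_mxE (y : 'cV[R]_p) (x : 'cV[R]_n) (l : 'cV[R]_m) :
  let r := eta *: (A *m x) - l in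
  admm_mx p A eta *m pdvec y x l = pdvec 0 (A^T *m r) (- (eta^-1 *: r)).
Proof.
rewrite /admm_mx /pdvec /= !mul_block_col !mul0mx !add0r.
rewrite mulmxBr -scalemxAr -scalemxAl mulmxA !mulNmx mul_scalar_mx.
by rewrite scalerBr scalerA mulVf ?gt_eqF // scale1r opprB [- _ + _]addrC.
Qed.

Lemma admm_mx_psd : psd (admm_mx p A eta).
Proof.
split.
  rewrite /admm_mx !tr_block_mx !trmx0 !linearN /= trmxK linearZ /= trmx_mul.
  by rewrite trmxK tr_scalar_mx.
move=> u; rewrite -[u]vsubmxK -[dsubmx u]vsubmxK.
set x := usubmx (dsubmx u); set l := dsubmx (dsubmx u).
rewrite -/(pdvec _ _ _) admm_mxE; set r := _ - l.
suff -> : dot (pdvec (usubmx u) x l) (pdvec 0 (A^T *m r) (- (eta^-1 *: r)))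
    = eta^-1 * dot r r.
  by rewrite mulr_ge0 ?dot_ge0 // invr_ge0 ltW.
rewrite /pdvec !dot_col_mx (dotC x) dot_trmxl dotNr dotZr.
have -> : dot (usubmx u) 0 = 0 by rewrite /dot mulmx0 mxE.
have rr : dot r r = eta * dot r (A *m x) - dot l r.
  by rewrite (dotC r (A *m x)) {1}/r dotDl dotNl dotZl.
by rewrite rr add0r mulrBr mulKf ?gt_eqF.
Qed.

End Preconditioner.

Theorem lemma3 (R : realType) (n p m : nat)
  (f : 'cV[R]_n -> \bar R) (g : 'cV[R]_p -> \bar R)
  (A : 'M[R]_(m, n)) (B : 'M[R]_(m, p)) (b : 'cV[R]_m) (eta : R)
  (f_proper : proper_fun f) (f_lsc : lower_semicontinuous f)
  (f_convex : econvex f)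
  (g_proper : proper_fun g) (g_lsc : lower_semicontinuous g)
  (g_convex : econvex g)
  (eta_gt0 : 0 < eta)
  (y : nat -> 'cV[R]_p) (x : nat -> 'cV[R]_n) (lam : nat -> 'cV[R]_m)
  (yxlam_admm : admm f g A B b eta y x lam) :
  let z := fun k => pdvec (y k) (x k) (lam k) in
  let P := admm_mx p A eta in
  psd P /\
  forall k : nat, P *m (z k - z k.+1) \in saddle_op f g A B b (z k.+1).
Proof.
move=> z P; split; first exact: admm_mx_psd.
move=> k; rewrite inE /saddle_op /= /z /pdvec !(col_mxKu, col_mxKd).
have [ymin lamS xmin] := yxlam_admm k.
set res := A *m x k.+1 + B *m y k.+1 - b.
exists (B^T *m lam k.+1); last exists (A^T *m lam k.+1 - eta *: (A^T *m res)).
- rewrite lamS mulmxBr -scalemxAr.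
  apply: (subdiff_argmin_penalty
    (r := fun y' => A *m x k + B *m y' - b)) ymin => // y' d.
  by rewrite mulmxDr addrA [LHS]addrAC.
- apply: (subdiff_argmin_penalty
    (r := fun x' => A *m x' + B *m y k.+1 - b)) xmin => // x' d.
  by rewrite mulmxDr !(addrAC _ _ (A *m d)).
have -> : col_mx (y k) (col_mx (x k) (lam k))
    - col_mx (y k.+1) (col_mx (x k.+1) (lam k.+1))
    = pdvec (y k - y k.+1) (x k - x k.+1) (lam k - lam k.+1).
  by rewrite /pdvec !opp_col_mx !add_col_mx.
rewrite admm_mxE //.
have -> : eta *: (A *m (x k - x k.+1)) - (lam k - lam k.+1) = - (eta *: res).
  rewrite lamS subKr -scalerBr -scalerN mulmxBr /res; congr (_ *: _).
  by apply/matrixP => i j; rewrite !mxE; ring.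
rewrite subrr mulmxN -scalemxAr addrAC subrr add0r.
by rewrite scalerN opprK scalerA mulVf ?gt_eqF // scale1r.
Qed.
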